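(* For every integer $k\ge 2$ and every $n\ge 8k^2$, $$\alpha_1(KG(n,k))=\binom{n-1}{k-1}+1.$$ Furthermore, for such $k$ and $n$, if $\mathcal{F}\subseteq\binom{[n]}{k}$ is a robust independent family in $KG(n,k)$ such that for every $x\in[n]$ there exist two distinct sets $F_x,G_x\in\mathcal{F}$ with $x\notin F_x$ and $x\notin G_x$, then $|\mathcal{F}|\le 8k\binom{n-2}{k-2}$.
   Context: For integers $k\ge 2$, $n\ge 2k$, the Kneser graph $KG(n,k)$ has vertex set $\binom{[n]}{k}$ (the $k$-element subsets of $[n]=\{1,\dots,n\}$), two sets being adjacent iff they are disjoint. A 1-selection of a graph $G=(V,E)$ is a map $f$ assigning to each vertex $v$ a set $f(v)$ of at most one edge incident with $v$; the 1-removed subgraph $G_f$ has vertex set $V$ and edge set $E\setminus\bigcup_{v}f(v)$. A set $U\subseteq V$ is robust independent if there is a 1-selection $f$ such that $U$ is independent in $G_f$. The robust independence number is $\alpha_1(G)=\max_f\alpha(G_f)$ over all 1-selections $f$. *)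

(* Defs.v *)
From mathcomp Require Import all_boot.

Set Implicit Arguments.
Unset Strict Implicit.
Unset Printing Implicit Defensive.

(* A finite simple graph is given by its vertex type V and its adjacency
   relation e, which is meant to be symmetric and irreflexive; edges are the
   unordered pairs [set u; v] of adjacent vertices. *)
Section Graphs.
Variables (V : finType) (e : rel V).

Definition edges : {set {set V}} :=
  [set [set p.1; p.2] | p : V * V & e p.1 p.2].

Definition independent (U : {set V}) : bool :=
  [forall u in U, forall v in U, ~~ e u v].

Definition independence_number : nat :=
  \max_(U : {set V} | independent U) #|U|.

Definition one_selection (f : {ffun V -> {set {set V}}}) : bool :=
  [forall v, (f v \subset [set d in edges | v \in d]) && (#|f v| <= 1)].

Definition one_removed (f : {ffun V -> {set {set V}}}) : rel V :=
  fun u v => e u v && ([set u; v] \notin \bigcup_w f w).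

End Graphs.

Definition robust_independent (V : finType) (e : rel V) (U : {set V}) : bool :=
  [exists f, one_selection e f && independent (one_removed e f) U].

Definition robust_independence_number (V : finType) (e : rel V) : nat :=
  \max_(f : {ffun V -> {set {set V}}} | one_selection e f)
    independence_number (one_removed e f).

(* The ground set [n] is represented by 'I_n = {0, ..., n - 1}. *)
Definition ksubset (n k : nat) : finType := {A : {set 'I_n} | #|A| == k}.

Definition kneser (n k : nat) : rel (ksubset n k) :=
  fun A B => [disjoint val A & val B].

Lemma kneser_sym (n k : nat) : symmetric (@kneser n k).
Proof. by move=> A B; rewrite /kneser disjoint_sym. Qed.

Lemma kneser_irr (n k : nat) : 0 < k -> irreflexive (@kneser n k).
Proof.
move=> k_gt0 A; apply/negbTE; rewrite /kneser -setI_eq0 setIid -card_gt0.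
by rewrite (eqP (valP A)).
Qed.

(* Main.v *)
Require Import Defs.
From mathcomp Require Import all_boot.
From mathcomp Require Import zify.

Set Implicit Arguments.
Unset Strict Implicit.
Unset Printing Implicit Defensive.

(** Let [F] be robust independent. Orienting each selected edge away from the
    vertex selecting it gives a map [g] such that any two disjoint [A, B] in [F]
    satisfy [B = g A] or [A = g B]. Hence two distinct members of [F] have at
    most two common neighbours in [F], and some member of [F] is disjoint from
    at most two others.

    Let [t >= 2] be the least size of a set [T] disjoint from at most two members
    of [F]; then [t <= k]. Write [d S] for the number of members of [F] containing
    [S]. If [0 < |S| < t], two members [A, B] of [F] avoid [S] (by hypothesis when
    [|S| = 1], by minimality of [t] otherwise), and all but two of
    the members containing [S] meet [A :|: B]; thus [d S <= 2 + 2k max_y d (y |: S)].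
    Iterating up to size [t] gives
    [|F| <= 2 + \sum_(x in T) d [set x] <= 2t (2k)^(t-1) 'C(n-t, k-t)],
    and as [n >= 8k^2] each step ['C(n-s, k-s)] to ['C(n-s-1, k-s-1)] gains a
    factor [8k], so the worst case is [t = 2].

    This bound is at most ['C(n-1, k-1)]; so a family exceeding it has at most one
    member outside some star, and a star with one further set is robust. *)

(** * Counting sets that contain a given set *)

Lemma card_ksubset_containing (n k : nat) (S : {set 'I_n}) : #|S| <= k ->
  #|[set A : ksubset n k | S \subset val A]| = 'C(n - #|S|, k - #|S|).
Proof.
move=> leSk.
have cSC : #|~: S| = n - #|S| by rewrite cardsCs setCK card_ord.
rewrite -cSC -cards_draws.
rewrite -(card_in_imset (f := fun A : ksubset n k => val A :\: S)).
  apply: eq_card => B; rewrite !inE; apply/imsetP/andP.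
    case=> A; rewrite inE => sSA ->; split; first by rewrite setDE subsetIr.
    by rewrite cardsD (setIidPr sSA) (eqP (valP A)).
  case=> sB /eqP cB.
  have disj : B :&: S = set0.
    by apply/eqP; rewrite setI_eq0 disjoints_subset.
  have cBS : #|S :|: B| == k.
    by rewrite cardsU setIC disj cards0 subn0 cB subnKC.
  exists (exist _ (S :|: B) cBS); first by rewrite inE /= subsetUl.
  by rewrite /= setDUl setDv set0U; apply/esym/setDidPl; rewrite -setI_eq0 disj.
move=> A B; rewrite !inE => sA sB eqD; apply: val_inj.
by rewrite -(setID (val A) S) -(setID (val B) S) eqD (setIidPr sA) (setIidPr sB).
Qed.

(** By [mul_bin_diag], one step at [i = s + j] amounts to [8k (k - i) <= n - i], which follows from
    [8k^2 <= n]. *)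
Lemma bin_ratio (n k s j : nat) : 8 * k ^ 2 <= n -> s + j <= k ->
  (8 * k) ^ j * 'C(n - (s + j), k - (s + j)) <= 'C(n - s, k - s).
Proof.
move=> hn; elim: j => [|j IHj] hj; first by rewrite addn0 mul1n.
apply: leq_trans (IHj _); last by lia.
rewrite expnSr -mulnA leq_mul2l; apply/orP; right.
have [m Em] : exists m, k - (s + j) = m.+1 by exists (k - (s + j)).-1; lia.
have [p Ep] : exists p, n - (s + j) = p.+1 by exists (n - (s + j)).-1; nia.
have -> : k - (s + j.+1) = m by lia.
have -> : n - (s + j.+1) = p by lia.
rewrite Em Ep -(@leq_pmul2l m.+1) // -mul_bin_diag mulnA leq_mul2r.
by apply/orP; right; nia.
Qed.

(** * Robust independent sets in an arbitrary graph *)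

Section RobustFamily.

Variables (V : finType) (e : rel V) (U : {set V}).

Lemma robust_independent_orientation : robust_independent e U ->
  exists g : V -> V, {in U &, forall u v, e u v -> v = g u \/ u = g v}.
Proof.
case/existsP=> f /andP[/forallP sel /forall_inP indep].
(* The default [u] only concerns vertices that select no edge, which [gE] never meets. *)
pose g u := odflt u [pick v | [set u; v] \in f u].
have gE u v : [set u; v] \in f u -> v = g u.
  move=> fuv; rewrite /g; case: pickP => [w fuw|/(_ v)]; last by rewrite fuv.
  have [_ /card_le1_eqP eqf] := andP (sel u).
  have E := eqf _ _ fuv fuw.
  have : v \in [set u; w] by rewrite E set22.
  have : w \in [set u; v] by rewrite -E set22.
  by rewrite !inE => /orP[/eqP->|/eqP->//]; rewrite orbb => /eqP.
exists g => u v uU vU euv.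
have /forall_inP/(_ v vU) := indep u uU.
rewrite /one_removed euv negbK => /bigcupP[w _ fw].
have [/subsetP/(_ _ fw)] := andP (sel w).
rewrite !inE => /andP[_ /orP[/eqP Ew | /eqP Ew]] _; rewrite Ew in fw.
  by left; apply: gE.
by right; apply: gE; rewrite setUC.
Qed.

Hypothesis robU : robust_independent e U.

(** A common neighbour [w] is [g u] or [g v]: otherwise [u = g w = v]. *)
Lemma robust_common_neighbors (u v : V) (M : {set V}) : u \in U -> v \in U ->
  u != v -> M \subset U -> {in M, forall w, e u w && e v w} -> #|M| <= 2.
Proof.
have [g gP] := robust_independent_orientation robU.
move=> uU vU neq_uv /subsetP sMU adj.
suff sM : M \subset [set g u; g v].
  by apply: leq_trans (subset_leq_card sM) _; rewrite cards2; case: (_ != _).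
apply/subsetP=> w wM; have /andP[euw evw] := adj w wM.
have wU := sMU w wM; rewrite !inE.
have [-> | Eu] := gP u w uU wU euw; first by rewrite eqxx.
have [-> | Ev] := gP v w vU wU evw; first by rewrite eqxx orbT.
by rewrite Eu Ev eqxx in neq_uv.
Qed.

(** Double counting: if all degrees were at least 3, then [3 #|U|] would be at most [#|U|] plus the
    sum of the in-degrees of [g], hence at most [2 #|U|]. *)
Lemma robust_low_degree : U != set0 ->
  exists2 u, u \in U & #|[set v in U | e u v]| <= 2.
Proof.
have [g gP] := robust_independent_orientation robU.
move=> U0.
case: (boolP [exists u in U, #|[set v in U | e u v]| <= 2]).
  by case/exists_inP=> u; exists u.
rewrite negb_exists_in => /forall_inP big.
have outdeg : \sum_(u in U) #|[set v in U | e u v]|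
    <= \sum_(u in U) (1 + #|[set v in U | g v == u]|).
  apply: leq_sum => u uU; rewrite -(cards1 (g u)).
  apply: leq_trans (leq_card_setU _ _); apply/subset_leq_card/subsetP => v.
  rewrite !inE => /andP[vU euv]; rewrite vU /=.
  by case: (gP u v uU vU euv) => <-; rewrite eqxx ?orbT.
have indeg : \sum_(u in U) #|[set v in U | g v == u]| <= #|U|.
  rewrite -sum1_card.
  rewrite (eq_bigr (fun u => \sum_(v in U) (g v == u : nat))); last first.
    move=> u _; rewrite -sum1_card big_mkcond [RHS]big_mkcond.
    by apply: eq_bigr => v _; rewrite inE; case: (v \in U); case: eqP.
  rewrite exchange_big; apply: leq_sum => v _.
  rewrite -big_mkcondr /= sum1_card -(cards1 (g v)).
  apply/subset_leq_card/subsetP => u.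
  by rewrite !inE unfold_in /= => /andP[_ /eqP->].
have lower : \sum_(u in U) 3 <= \sum_(u in U) #|[set v in U | e u v]|.
  by apply: leq_sum => u /big; rewrite -ltnNge.
move: lower outdeg; rewrite big_split /= !sum_nat_const; move: U0 indeg.
by rewrite -card_gt0; lia.
Qed.

End RobustFamily.

(** * Degrees in a robust independent family of k-sets *)

Section KneserFamily.

Variables (n k : nat) (F : {set ksubset n k}).
Hypothesis robF : robust_independent (@kneser n k) F.

Let degree (S : {set 'I_n}) := #|[set A in F | S \subset val A]|.
Let avoiding (S : {set 'I_n}) := [set A in F | [disjoint S & val A]].

(** A union bound: a member that does not avoid [T] contains some [x] of [T]. *)
Lemma card_le_degree_sum (S T : {set 'I_n}) :
  degree S <= #|[set A in avoiding T | S \subset val A]|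
              + \sum_(x in T) degree (x |: S).
Proof.
pose D := \bigcup_(x in T) [set A in F | x |: S \subset val A].
have D_le : #|D| <= \sum_(x in T) degree (x |: S).
  rewrite /D; elim/big_ind2: _ => [|X m Y p hX hY|//]; first by rewrite cards0.
  exact: leq_trans (leq_card_setU _ _) (leq_add hX hY).
apply: leq_trans (leq_add (leqnn _) D_le).
apply: leq_trans (leq_card_setU _ _); apply/subset_leq_card/subsetP => A.
rewrite !inE => /andP[AF sSA]; rewrite AF sSA andbT /=.
case: (boolP [disjoint T & val A]) => //= /pred0Pn[x /andP[/= xT xA]].
by apply/bigcupP; exists x => //; rewrite inE AF subUset sub1set xA.
Qed.

Lemma degree_step (S : {set 'I_n}) (D : nat) : 2 <= #|avoiding S| ->
  (forall y, y \notin S -> degree (y |: S) <= D) -> degree S <= 2 + 2 * k * D.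
Proof.
case/card_gt1P=> A [B [AS BS neqAB]] hD.
move: AS BS; rewrite !inE => /andP[AF dSA] /andP[BF dSB].
apply: leq_trans (card_le_degree_sum S (val A :|: val B)) _.
apply: leq_add.
  (* Members disjoint from [A :|: B] are common neighbours of [A] and [B]. *)
  apply: (robust_common_neighbors robF AF BF neqAB).
    by apply/subsetP=> C; rewrite !inE => /andP[/andP[]].
  move=> C; rewrite !inE => /andP[/andP[_ dC] _].
  by rewrite /kneser !(disjointWl _ dC) ?subsetUl ?subsetUr.
apply: (@leq_trans (\sum_(y in val A :|: val B) D)).
  apply: leq_sum => y; rewrite inE => yAB; apply: hD; apply/negP=> yS.
  by case/orP: yAB; [move: dSA | move: dSB] => /disjointFr/(_ yS) ->.
rewrite sum_nat_const leq_mul2r; apply/orP; right.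
apply: leq_trans (leq_card_setU _ _) _.
by rewrite (eqP (valP A)) (eqP (valP B)) mul2n addnn.
Qed.

(** The [+ 1] lets the induction absorb the additive 2 of [degree_step]:
    [2 + 2k (X - 1) + 1 <= 2k X] as [2k >= 3]. The leading factor 2 pays for it in the base case,
    where the binomial is positive. *)
Lemma degree_bound (t : nat) (S : {set 'I_n}) : 2 <= k <= n -> t <= k ->
  (forall S' : {set 'I_n}, 0 < #|S'| < t -> 2 <= #|avoiding S'|) -> 0 < #|S| <= t ->
  degree S + 1 <= 2 * (2 * k) ^ (t - #|S|) * 'C(n - t, k - t).
Proof.
move=> /andP[hk hkn] htk hav.
move Ej : (t - #|S|) => j.
elim: j S Ej => [|j IHj] S Ej /andP[S0 St].
  have ESt : #|S| = t by lia.
  rewrite muln1 -ESt -(card_ksubset_containing (k := k)); last by rewrite ESt.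
  have degS : degree S <= #|[set A : ksubset n k | S \subset val A]|.
    by apply/subset_leq_card/subsetP => A; rewrite !inE => /andP[].
  have : 0 < #|[set A : ksubset n k | S \subset val A]|.
    by rewrite card_ksubset_containing ?ESt // bin_gt0 leq_sub2r.
  by lia.
set X := 2 * (2 * k) ^ j * 'C(n - t, k - t).
have step : degree S <= 2 + 2 * k * (X - 1).
  apply: degree_step; first by apply: hav; lia.
  move=> y yS; have cyS : #|y |: S| = #|S|.+1 by rewrite cardsU1 yS.
  by have := IHj (y |: S); rewrite cyS -/X; lia.
have X0 : 0 < X.
  by rewrite !muln_gt0 expn_gt0 bin_gt0 muln_gt0 leq_sub2r // (ltnW hk).
have -> : 2 * (2 * k) ^ j.+1 * 'C(n - t, k - t) = 2 * k * X.
  by rewrite /X expnS; lia.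
by nia.
Qed.

Lemma robust_nontrivial_card : 2 <= k -> 8 * k ^ 2 <= n ->
  (forall x : 'I_n, 2 <= #|avoiding [set x]|) ->
  #|F| <= 8 * k * 'C(n - 2, k - 2).
Proof.
move=> hk hn hav1.
have [->|F0] := eqVneq F set0; first by rewrite cards0.
have hkn : k <= n by nia.
(* Size 1 is excluded because a singleton may be avoided by exactly two members; [hav1] covers
   singletons in [hav]. *)
pose good t := (2 <= t) && [exists T : {set 'I_n}, (#|T| == t) && (#|avoiding T| <= 2)].
(* The witness is a member of [F] of low degree. *)
have goodk : good k.
  rewrite /good hk /=; have [A AF degA] := robust_low_degree robF F0.
  by apply/existsP; exists (val A); rewrite (valP A).
have [t /andP[t2 /existsP[T /andP[/eqP cT avT]]] tmin] :=
  ex_minnP (ex_intro _ k goodk).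
have tk : t <= k := tmin k goodk.
have hav (S : {set 'I_n}) : 0 < #|S| < t -> 2 <= #|avoiding S|.
  move=> /andP[S0 St]; have [S2|S1] := leqP 2 #|S|; last first.
    by have /cards1P[x ->] : #|S| == 1 by lia.
  rewrite ltnNge; apply/negP=> avS; suff : t <= #|S| by lia.
  by apply: tmin; rewrite /good S2; apply/existsP; exists S; rewrite eqxx; lia.
set X := (2 * k) ^ (t - 2) * 'C(n - t, k - t).
have deg1 x : degree [set x] <= 2 * (2 * k) * X - 1.
  have := degree_bound (S := [set x]) (t := t); rewrite hk hkn cards1.
  move=> /(_ isT tk hav); have -> : t - 1 = (t - 2).+1 by lia.
  rewrite expnS (ltnW t2) => /(_ isT).
  by rewrite (_ : 2 * _ * _ = 2 * (2 * k) * X); [lia | rewrite /X; lia].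
have F_le : #|F| <= 2 + t * (2 * (2 * k) * X - 1).
  have -> : #|F| = degree set0.
    by apply: eq_card => A; rewrite !inE sub0set andbT.
  apply: leq_trans (card_le_degree_sum set0 T) _; apply: leq_add.
    apply: leq_trans avT; apply/subset_leq_card/subsetP => A.
    by rewrite inE => /andP[].
  rewrite -{1}cT -sum_nat_const; apply: leq_sum => x _.
  by rewrite setU0; apply: deg1.
(* Since [8k = 4 * 2k], the ratio bound leaves a surplus [4 ^ (t - 2)], which pays for the factor
   [t] in [F_le]. *)
have ratio : 4 ^ (t - 2) * X <= 'C(n - 2, k - 2).
  have := @bin_ratio n k 2 (t - 2) hn; rewrite subnKC // => /(_ tk).
  by rewrite /X mulnA -expnMn (_ : 4 * (2 * k) = 8 * k) // mulnA.
have t_le : t <= 2 * 4 ^ (t - 2).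
  have : t - 2 < 4 ^ (t - 2) by apply: ltn_expl.
  by lia.
have X0 : 0 < X by rewrite muln_gt0 expn_gt0 bin_gt0 muln_gt0 leq_sub2r // (ltnW hk).
have : t * X <= 2 * 'C(n - 2, k - 2).
  by apply: leq_trans (leq_mul t_le (leqnn X)) _; rewrite -mulnA leq_mul2l.
(* As [t >= 2], the [- 1] in each of the [t] summands cancels the additive 2, leaving
   [#|F| <= 4k t X]. *)
by nia.
Qed.

End KneserFamily.

(** * The extremal family and the final comparison *)

(** Each vertex disjoint from [B] selects its edge to [B], so [B] becomes isolated; members of the
    star of [x] already meet in [x]. *)
Lemma star_plus_one (n k : nat) (x : 'I_n) (B : ksubset n k) :
  0 < k -> x \notin val B ->
  'C(n - 1, k - 1) + 1 <= robust_independence_number (@kneser n k).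
Proof.
move=> k0 xB; pose U := B |: [set A : ksubset n k | [set x] \subset val A].
have cU : #|U| = 'C(n - 1, k - 1) + 1.
  by rewrite cardsU1 inE sub1set xB card_ksubset_containing cards1 // addnC.
pose f : {ffun ksubset n k -> {set {set ksubset n k}}} :=
  [ffun A => if kneser A B then [set [set A; B]] else set0].
have sel : one_selection (@kneser n k) f.
  apply/forallP=> A; rewrite ffunE; case: ifP => AB; last first.
    by rewrite sub0set cards0.
  rewrite cards1 andbT sub1set !inE eqxx andbT.
  by apply/imsetP; exists (A, B); rewrite ?inE.
rewrite -cU; apply: leq_trans (leq_bigmax_cond _ sel).
apply: (leq_bigmax_cond (F := fun W : {set _} => #|W|)).
have covered A : kneser A B -> [set A; B] \in \bigcup_w f w.
  by move=> AB; apply/bigcupP; exists A; rewrite // ffunE AB set11.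
apply/forall_inP=> A AU; apply/forall_inP=> C CU; apply/negP.
case/andP=> AC; apply/negP; rewrite negbK.
move: AU CU; rewrite !inE !sub1set => /orP[/eqP EA|xA].
  by move=> _; rewrite EA setUC covered // kneser_sym -EA.
case/orP=> [/eqP EC|xC]; first by rewrite EC covered // -EC.
by move: AC; rewrite /kneser => /disjointFr/(_ xA); rewrite xC.
Qed.

Theorem theorem1p6 (n k : nat) (hk : 2 <= k) (hn : 8 * k ^ 2 <= n) :
  robust_independence_number (@kneser n k) = 'C(n - 1, k - 1) + 1 /\
  forall FF : {set ksubset n k},
    robust_independent (@kneser n k) FF ->
    (forall x : 'I_n, exists F G : ksubset n k,
       [/\ F \in FF, G \in FF, F != G, x \notin val F & x \notin val G]) ->
    #|FF| <= 8 * k * 'C(n - 2, k - 2).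
Proof.
split; last first.
  move=> FF robFF hFF; apply: robust_nontrivial_card => // x.
  have [A [B [AF BF neqAB xA xB]]] := hFF x.
  by apply/card_gt1P; exists A, B; split; rewrite // inE ?AF ?BF disjoints1.
have hkn : k < n by nia.
apply/eqP; rewrite eqn_leq; apply/andP; split; last first.
  pose x : 'I_n := Ordinal (leq_ltn_trans (leq0n k) hkn).
  have : 0 < #|[set B : {set 'I_n} | (B \subset [set~ x]) & #|B| == k]|.
    by rewrite cards_draws bin_gt0 cardsC1 card_ord; lia.
  case/card_gt0P=> B; rewrite inE subsetC sub1set inE => /andP[xB cB].
  by apply: (@star_plus_one n k x (exist _ B cB)); rewrite // (ltnW hk).
apply/bigmax_leqP=> f sel; apply/bigmax_leqP=> U indepU.
have robU : robust_independent (@kneser n k) U by apply/existsP; exists f; rewrite sel.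
case: (boolP [forall x, 2 <= #|[set A in U | [disjoint [set x] & val A]]|]).
  (* Here [bin_ratio] with [s = j = 1] puts the nontrivial bound below the size of a star. *)
  move/forallP=> hav; apply: leq_trans (robust_nontrivial_card robU hk hn hav) _.
  by rewrite addn1 leqW //; apply: (@bin_ratio n k 1 1 hn hk).
(* Otherwise some [x] is missed by at most one member of [U]. *)
rewrite negb_forall => /existsP[x]; rewrite -ltnNge ltnS => few.
have -> : 'C(n - 1, k - 1) = #|[set A : ksubset n k | [set x] \subset val A]|.
  by rewrite card_ksubset_containing cards1 // (ltnW hk).
apply: leq_trans (leq_add (leqnn _) few); apply: leq_trans (leq_card_setU _ _).
apply/subset_leq_card/subsetP=> A AU.
by rewrite !inE AU sub1set disjoints1 /=; case: (x \in val A).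
Qed.
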